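(* Let $\Sigma$ be a finite alphabet, $h:\Sigma^*\to M$ a monoid morphism into a finite monoid, and $L\subseteq\Sigma^*$. Assume that $L$ is $h$-substitutable and that the set $\mathcal P$ of relative primes is finite. Then (1) VTE$_1$ holds if and only if $\mathrm{Unsat}_P=\varnothing$ for every $P\in\mathcal P$; (2) FRP holds if and only if $|\mathrm{Unsat}_P|<\infty$ for every $P\in\mathcal P$, if and only if $\rho_\partial(L,h)<\infty$; (3) FSRP holds if and only if $\mathrm{Unsat}_P$ is a regular language over $\mathcal P$ for every $P\in\mathcal P$, if and only if $\kappa_\partial(L,h)<\infty$. Moreover $\rho(L,h)<\infty$ if and only if $\rho_\partial(L,h)<\infty$.
   Context: $D_L(x)=\{(u,v):uxv\in L\}$; $x\equiv_L y$ iff $D_L(x)=D_L(y)$. $L$ is $h$-substitutable if for all $x,y\in\Sigma^*$, $h(x)=h(y)$ and $D_L(x)\cap D_L(y)\ne\varnothing$ imply $x\equiv_L y$. The relative syntactic congruence $\theta$ is: $x\,\theta\,y$ iff $x\equiv_L y$ and $h(x)=h(y)$; its classes $[x]$ are called relative classes. A relative class is live if $D_L(x)\neq\varnothing$ for its members. The unit class is $[\varepsilon]$. For relative classes: $X\cdot Y=\{xy:x\in X,y\in Y\}$ and $X*Y=[xy]$ for any $x\in X,y\in Y$. A relative prime is a live relative class $P\ne[\varepsilon]$ such that whenever $P=X\cdot Y$ (equality of sets) for relative classes $X,Y$, one of $X,Y$ is $[\varepsilon]$. For a nonempty prime sequence $\alpha=P_1\cdots P_k$ put $\overline\alpha=P_1\cdot\ldots\cdot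 P_k\subseteq\Sigma^*$ and $[\overline\alpha]=P_1*\cdots*P_k$. For $P\in\mathcal P$ and $\alpha\in\mathcal P^*$ with $|\alpha|\ge2$, the production $P\to\alpha$ is correct if $[\overline\alpha]=P$; $\alpha$ is pleonastic if some proper contiguous block $\beta$ of $\alpha$ with $|\beta|\ge2$ has $[\overline\beta]\in\mathcal P$; a correct production is valid if its right-hand side is not pleonastic. $\mathrm{Val}_P=\{\alpha:P\to\alpha\text{ is valid}\}$. A valid production $P\to A\alpha$ ($A\in\mathcal P$, $\alpha\in\mathcal P^+$) is tail-saturated if $\overline\alpha=[\overline\alpha]$ and tail-under-saturated otherwise; $\mathrm{Unsat}_P\subseteq\mathrm{Val}_P$ is the set of (complete) right-hand sides $A\alpha$ of tail-under-saturated valid productions with left-hand prime $P$. VTE$_1$: for every valid production $P\to A\alpha$ with $A\in\mathcal P$, $\alpha\in\mathcal P^+$, $\overline\alpha=[\overline\alpha]$. FRP: $\mathcal P$ is finite and the set of valid productions is finite. FSRP: $\mathcal P$ is finite and every $\mathrm{Val}_P$ is a regular language over $\mathcal P$. $\rho(L,h)=\sup\{|\alpha|:\alpha\in\mathrm{Val}_P\text{ for some }P\in\mathcal P\}$; $\rho_\partial(L,h)=\sup\{|\alpha|:\alpha\in\mathrm{Unsat}_P\text{ for some }P\in\mathcal P\}$ (the supremum of the empty set is $0$). For $u\in\mathcal P^*$ and $K\subseteq\mathcal P^*$, $u^{-1}K=\{v:uv\in K\}$; $\kappa_\partial(L,h)=|\{u^{-1}\mathrm{Unsat}_P:P\in\mathcal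 P,\ u\in\mathcal P^*,\ u^{-1}\mathrm{Unsat}_P\neq\varnothing\}|$. *)

(* Defs.v *)
From HB Require Import structures.
From mathcomp Require Import all_boot all_order all_algebra.
From mathcomp Require Import finmap.
From mathcomp Require Import mathcomp_extra boolp classical_sets functions.
From mathcomp Require Import cardinality constructive_ereal.

Set Implicit Arguments.
Unset Strict Implicit.
Unset Printing Implicit Defensive.

Local Open Scope classical_set_scope.

Definition word_morphism (T : Type) (M : monoidType) (h : seq T -> M) : Prop :=
  h [::] = 1%g /\ forall x y, h (x ++ y) = (h x * h y)%g.

(* Recognizability by a complete deterministic finite automaton; this is
   regularity as soon as the alphabet [A] is finite. *)
Definition regular (A : Type) (K : set (seq A)) : Prop :=
  exists (Q : finType) (q0 : Q) (delta : Q -> A -> Q) (F : {set Q}),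
    forall w, K w <-> foldl delta q0 w \in F.

Definition residual (A : Type) (u : seq A) (K : set (seq A)) : set (seq A) :=
  [set v | K (u ++ v)].

(* Extended natural numbers are represented in [\bar int]. *)
Definition ecard (T : choiceType) (X : set T) : \bar int :=
  if `[< finite_set X >] then (Posz #|` fset_set X|)%:E else +oo%E.

Definition sup_size (A : Type) (K : set (seq A)) : \bar int :=
  supremum 0%E [set (Posz (size w))%:E | w in K].

Section RelativeClasses.
Variables (Sigma : finType) (M : monoidType).
Variables (h : seq Sigma -> M) (L : set (seq Sigma)).
Implicit Types (x y z : seq Sigma) (X Y : set (seq Sigma)).

Definition contexts x : set (seq Sigma * seq Sigma) :=
  [set c | L (c.1 ++ x ++ c.2)].

Definition syn_eq x y : Prop := contexts x = contexts y.

Definition substitutable : Prop :=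
  forall x y, h x = h y -> contexts x `&` contexts y !=set0 -> syn_eq x y.

Definition theta x y : Prop := syn_eq x y /\ h x = h y.

Definition rel_class x : set (seq Sigma) := [set y | theta x y].

Definition is_rel_class X : Prop := exists x, X = rel_class x.

Definition unit_class : set (seq Sigma) := rel_class [::].

Definition live X : Prop := forall x, X x -> contexts x !=set0.

Definition set_prod X Y : set (seq Sigma) :=
  [set z | exists x y, [/\ X x, Y y & z = x ++ y]].

(* The union of the classes of all [x ++ y] with [x] in [X] and [y] in [Y]:
   for relative classes these all coincide, see [class_prod_rel_class]. *)
Definition class_prod X Y : set (seq Sigma) :=
  [set z | exists x y, [/\ X x, Y y & rel_class (x ++ y) z]].

Lemma theta_cat x x' y y' : word_morphism h ->
  theta x x' -> theta y y' -> theta (x ++ y) (x' ++ y').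
Proof.
move=> [_ hM] [Dx hx] [Dy hy]; split; last by rewrite !hM hx hy.
apply/seteqP; split=> -[u v]; rewrite /contexts /= -!catA => Luv.
- have : contexts x (u, y ++ v) by [].
  rewrite Dx /contexts /= catA => Luv'.
  have : contexts y (u ++ x', v) by [].
  by rewrite Dy /contexts /= -catA.
- have : contexts y' (u ++ x', v) by rewrite /contexts /= -catA.
  rewrite -Dy /contexts /= -catA => Luv'.
  have : contexts x' (u, y ++ v) by [].
  by rewrite -Dx.
Qed.

Lemma class_prod_rel_class x y : word_morphism h ->
  class_prod (rel_class x) (rel_class y) = rel_class (x ++ y).
Proof.
move=> hM; apply/seteqP; split=> z.
- move=> [x' [y' [xx' yy' [D' h']]]].
  have [D'' h''] := theta_cat hM xx' yy'.
  by split; [rewrite /syn_eq D'' D' | rewrite h'' h'].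
- by move=> xyz; exists x, y; split.
Qed.

Definition rel_primes : set (set (seq Sigma)) :=
  [set P | [/\ is_rel_class P, live P, P <> unit_class &
    forall X Y, is_rel_class X -> is_rel_class Y ->
      P = set_prod X Y -> X = unit_class \/ Y = unit_class]].

(* The type of relative primes: the alphabet of prime sequences. *)
Definition rprime : Type := set_type rel_primes.

(* The concatenation of the members of [a] as sets of words, and their product
   as relative classes. The value at the empty sequence is a convention. *)
Definition seq_prod (a : seq rprime) : set (seq Sigma) :=
  foldr (fun P X => set_prod (val P) X) [set [::]] a.

Definition seq_class (a : seq rprime) : set (seq Sigma) :=
  foldr (fun P X => class_prod (val P) X) unit_class a.

Definition correct (P : rprime) (a : seq rprime) : Prop :=
  (1 < size a)%N /\ seq_class a = val P.

Definition pleonastic (a : seq rprime) : Prop :=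
  exists b1 b b2 : seq rprime,
    [/\ a = b1 ++ b ++ b2, b <> a, (1 < size b)%N & rel_primes (seq_class b)].

Definition Val (P : rprime) : set (seq rprime) :=
  [set a | correct P a /\ ~ pleonastic a].

Definition tail_saturated (a : seq rprime) : Prop := seq_prod a = seq_class a.

Definition Unsat (P : rprime) : set (seq rprime) :=
  [set w | Val P w /\
    exists (A : rprime) (a : seq rprime),
      [/\ w = A :: a, a <> [::] & ~ tail_saturated a]].

Definition VTE1 : Prop :=
  forall (P A : rprime) (a : seq rprime),
    a <> [::] -> Val P (A :: a) -> seq_prod a = seq_class a.

Definition FRP : Prop :=
  finite_set rel_primes /\
  finite_set [set p : rprime * seq rprime | Val p.1 p.2].

Definition FSRP : Prop :=
  finite_set rel_primes /\ forall P : rprime, regular (Val P).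

Definition rho : \bar int := sup_size (\bigcup_(P : rprime) Val P).

Definition rho_partial : \bar int := sup_size (\bigcup_(P : rprime) Unsat P).

Definition kappa_partial : \bar int :=
  ecard [set K : set (seq rprime) |
    K !=set0 /\ exists (P : rprime) (u : seq rprime), K = residual u (Unsat P)].

End RelativeClasses.

(* Main.v *)
(* Substitutability makes the class of the tail of a valid production P -> A a
   depend only on P, A and the value of the tail under h, so only finitely many
   classes occur. When the tail is saturated, its class is a product of size a
   sets of non-empty words, so size a is at most the length of any word of the
   class. Hence the saturated right-hand sides form a finite set, and Val_P and
   Unsat_P differ by a finite set, which changes neither finiteness nor
   regularity (finiteness of the set of residuals). *)
Require Import Defs.
From mathcomp Require Import all_boot all_order all_algebra.
From mathcomp Require Import boolp classical_sets cardinality constructive_ereal.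

Set Implicit Arguments.
Unset Strict Implicit.
Unset Printing Implicit Defensive.

Import Order.TTheory Num.Theory.

Local Open Scope classical_set_scope.

(** * Sets of words of bounded length *)

Definition bounded_size (A : Type) (K : set (seq A)) : Prop :=
  exists n, forall w, K w -> (size w <= n)%N.

Lemma bounded_size_sub {A : Type} {K K' : set (seq A)} :
  K `<=` K' -> bounded_size K' -> bounded_size K.
Proof. by move=> KK' [n nP]; exists n => w /KK' /nP. Qed.

Lemma bounded_sizeU {A : Type} {K K' : set (seq A)} :
  bounded_size K -> bounded_size K' -> bounded_size (K `|` K').
Proof.
move=> [n nP] [m mP]; exists (maxn n m) => w; rewrite leq_max.
by case=> [/nP -> | /mP ->]; rewrite ?orbT.
Qed.

Lemma finite_nat_bounded {D : set nat} :
  finite_set D -> exists n, forall k, D k -> (k <= n)%N.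
Proof.
move=> /finite_seqP[s ->]; exists (\max_(k <- s) k) => k /= ks.
exact: (@leq_bigmax_seq _ s xpredT id).
Qed.

Lemma finite_bounded_size {A : Type} {K : set (seq A)} :
  finite_set K -> bounded_size K.
Proof.
move=> /(finite_image size)/finite_nat_bounded[n nP].
by exists n => w Kw; apply: nP; exists w.
Qed.

Lemma bounded_size_bigcup {T A : Type} (F : T -> set (seq A)) :
  finite_set [set: T] -> (forall t, bounded_size (F t)) ->
  bounded_size (\bigcup_(t : T) F t).
Proof.
move=> Tfin /choice[f fP].
have [n nP] := finite_nat_bounded (finite_image f Tfin).
exists n => w [t _ Ftw]; apply: leq_trans (fP t w Ftw) _.
by apply: nP; exists t.
Qed.

Lemma bounded_size_finite {A : Type} {K : set (seq A)} :
  finite_set [set: A] -> bounded_size K -> finite_set K.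
Proof.
move=> Afin [n nP]; apply: (sub_finite_set (B := [set w | (size w <= n)%N])).
  by move=> w /nP.
elim: n {K nP} => [|n IHn].
  by apply: (sub_finite_set (B := [set [::]])) => // -[].
apply: (sub_finite_set
  (B := [set [::]] `|`
        [set a :: w | a in [set: A] & w in [set w | (size w <= n)%N]])).
- by case=> [|a w] /= sw; [left | right; exists a => //; exists w].
- by rewrite finite_setU; split; [exact: finite_set1 | exact: finite_image2].
Qed.

(** [supremum] selects some least upper bound by choice; antisymmetry leaves only one candidate. *)
Lemma supremumE {d : Order.disp_t} {T : porderType d} {x0 x : T} {D : set T} :
  D !=set0 -> supremums D x -> supremum x0 D = x.
Proof.
rewrite /supremum => /set0P/negbTE -> Dx.
exact: (is_subset1_supremums (xgetPex _ (ex_intro _ x Dx)) Dx).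
Qed.

Lemma sup_size_ltey {A : Type} (K : set (seq A)) :
  (sup_size K < +oo)%E <-> bounded_size K.
Proof.
rewrite /sup_size; set S := [set _ | _ in _]; split=> [supS|[n nP]].
- apply: contrapT => Kunb.
  have large n : exists2 w, K w & (n < size w)%N.
    apply: contrapT => Kn; apply: Kunb; exists n => w Kw; rewrite leqNgt.
    by apply/negP => nw; apply: Kn; exists w.
  suff supSE : supremum 0%E S = +oo%E by rewrite supSE in supS.
  apply: supremumE.
    by have [w Kw _] := large 0%N; exists (Posz (size w))%:E, w.
  split=> [x _|y Sy]; first exact: leey.
  (* No upper bound lies below [+oo]: an integer [z] is exceeded by a word longer than its absolute
     value, and [-oo] by any word. *)
  case: y Sy => [z Sz|_|Sy]; [|exact: lexx|].
  + have [w Kw zw] := large `|z|%N.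
    have : ((Posz (size w))%:E <= z%:E)%E by apply: Sz; exists w.
    rewrite lee_fin leNgt => /negP[].
    by apply: le_lt_trans (ler_norm z) _; rewrite -abszE ltz_nat.
  + have [w Kw _] := large 0%N.
    by have := Sy _ (ex_intro2 _ _ w Kw erefl); rewrite leeNy_eq.
(* For empty [K] the supremum is the default value 0; otherwise it is the largest length, which is
   attained. *)
- have [[w0 Kw0]|/nonemptyPn K0] := pselect (K !=set0); last first.
    by rewrite /S K0 image_set0 supremum0.
  pose p k := `[< exists2 w, K w & size w = k >].
  have p0 : exists k, p k by exists (size w0); apply/asboolP; exists w0.
  have pn k : p k -> (k <= n)%N by move=> /asboolP[w /nP wn <-].
  have [k /asboolP[w Kw <-] kmax] := ex_maxnP p0 pn.
  rewrite (@supremumE _ _ _ (Posz (size w))%:E) ?ltey //.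
    by exists (Posz (size w))%:E, w.
  split=> [_ [v Kv <-]|y]; last by apply; exists w.
  by rewrite lee_fin lez_nat; apply: kmax; apply/asboolP; exists v.
Qed.

(** A subset of an enumerated set is cut out by a bit mask along the enumeration, and there are
    finitely many masks. *)
Lemma finite_powerset {T : Type} (D : set T) :
  finite_set D -> finite_set [set E | E `<=` D].
Proof.
elim/Pchoice: T => T in D *; move=> /finite_seqP[s ->].
have tfin : finite_set [set: (size s).-tuple bool].
  exact: finite_finset.
apply: sub_finite_set (finite_image
  (fun m : (size s).-tuple bool => [set` mask m s]) tfin).
move=> E Es; exists (map_tuple (fun x => `[< E x >]) (in_tuple s)) => //=.
rewrite -filter_mask; apply/seteqP; split=> x /=; rewrite mem_filter.
- by move=> /andP[/asboolP].
- by move=> Ex; apply/andP; split; [exact/asboolP | exact: Es].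
Qed.

(** * Regularity through residuals *)

Definition residuals (A : Type) (K : set (seq A)) : set (set (seq A)) :=
  range (fun u => residual u K).

(** Myhill-Nerode. The residual by [u] is the language accepted from the state reached on [u];
    conversely the residuals serve as states, reading a letter takes a further residual, and the
    accepting ones contain the empty word. *)
Lemma regularP {A : Type} (K : set (seq A)) :
  regular K <-> finite_set (residuals K).
Proof.
split=> [[Q [q0 [delta [F KP]]]]|/finite_seqP[s sE]].
- have Qfin : finite_set [set: Q].
    exact: finite_finset.
  apply: sub_finite_set (finite_image
    (fun q => [set v | foldl delta q v \in F]) Qfin).
  move=> _ [u _ <-]; exists (foldl delta q0 u) => //.
  by apply/seteqP; split=> v /=; rewrite /residual /= KP foldl_cat.
- have mem_s X : residuals K X -> X \in s by rewrite sE.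
  have step (q : seq_sub s) a : residual [:: a] (ssval q) \in s.
    have : residuals K (ssval q) by rewrite sE /=; exact: ssvalP.
    move=> [u _ <-]; apply: mem_s; exists (u ++ [:: a]) => //.
    by apply/seteqP; split=> v; rewrite /residual /= -catA.
  have K0 : K \in s by apply: mem_s; exists [::].
  exists (seq_sub s), (SeqSub K0), (fun q a => SeqSub (step q a)),
    (finset (fun q : seq_sub s => `[< ssval q [::] >])) => w.
  (* Generalize the initial state for the induction: started in [q], the automaton accepts exactly
     [ssval q]. *)
  rewrite -{1}[K]/(ssval (SeqSub K0)); move: (SeqSub K0).
  elim: w => [|a w IHw] q /=; first by rewrite inE; split => /asboolP.
  exact: (IHw (SeqSub (step q a))).
Qed.

Lemma finite_regular {A : Type} {K : set (seq A)} :
  finite_set [set: A] -> finite_set K -> regular K.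
Proof.
move=> Afin /finite_bounded_size[n nP]; apply/regularP.
have : finite_set [set w : seq A | (size w <= n)%N].
  by apply: bounded_size_finite => //; exists n.
(* Residuals only shorten words, so each one is a subset of the finite set of words of length at
   most [n]. *)
move=> /finite_powerset; apply: sub_finite_set.
move=> _ [u _ <-] v /nP; rewrite size_cat; apply: leq_trans.
exact: leq_addl.
Qed.

(** Taking residuals commutes with Boolean operations, so a residual of the union is determined by
    one residual of each language. *)
Lemma regularU {A : Type} {K K' : set (seq A)} :
  regular K -> regular K' -> regular (K `|` K').
Proof.
move=> /regularP Kreg /regularP K'reg; apply/regularP.
apply: sub_finite_set (finite_image2 (fun X Y => X `|` Y) Kreg K'reg).
move=> _ [u _ <-]; exists (residual u K); first by exists u.
by exists (residual u K') => //; exists u.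
Qed.

Lemma regularD {A : Type} {K K' : set (seq A)} :
  regular K -> regular K' -> regular (K `\` K').
Proof.
move=> /regularP Kreg /regularP K'reg; apply/regularP.
apply: sub_finite_set (finite_image2 (fun X Y => X `\` Y) Kreg K'reg).
move=> _ [u _ <-]; exists (residual u K); first by exists u.
by exists (residual u K') => //; exists u.
Qed.

Lemma ecard_ltey {T : choiceType} (X : set T) :
  (ecard X < +oo)%E <-> finite_set X.
Proof.
by rewrite /ecard; case: asboolP => // Xfin; split=> // _; exact: ltey.
Qed.

(** * Productions with saturated tails *)

Section SaturatedTails.
Variables (Sigma : finType) (M : monoidType).
Variables (h : seq Sigma -> M) (L : set (seq Sigma)).
Hypothesis h_morphism : word_morphism h.
Implicit Types (P A : rprime h L) (a : seq (rprime h L)).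

Lemma theta_rel_class x y : theta h L x y -> rel_class h L x = rel_class h L y.
Proof.
move=> [Dxy hxy]; apply/seteqP; split=> z [Dz hz]; split.
- by rewrite /syn_eq -Dxy.
- by rewrite -hxy.
- by rewrite /syn_eq Dxy.
- by rewrite hxy.
Qed.

Lemma prime_is_rel_class P : is_rel_class h L (val P).
Proof. by case: (set_valP P). Qed.

Lemma seq_class_is_rel_class a : is_rel_class h L (seq_class a).
Proof.
elim: a => [|A a [x /= ->]]; first by exists [::].
have [y ->] := prime_is_rel_class A.
by exists (y ++ x); exact: class_prod_rel_class.
Qed.

Lemma prime_nil P : ~ val P [::].
Proof.
case: (set_valP P) => -[x ->] _ x_unit _ /theta_rel_class; exact: x_unit.
Qed.

(** Primes do not contain the empty word, so every factor contributes at least one letter. *)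
Lemma size_seq_prod a x : seq_prod a x -> (size a <= size x)%N.
Proof.
elim: a x => [//|A a IHa] x /= [y [z [Ay /IHa sz ->]]].
rewrite size_cat -add1n leq_add //.
by case: y Ay => // /prime_nil.
Qed.

(* If [(u, v)] is a context of [P] and [y] is in [A], then [(u ++ y, v)] is a
   context of both tails, so substitutability applies. *)
Lemma tail_class_eq P A a a' x x' : substitutable h L ->
  seq_class (A :: a) = val P -> seq_class (A :: a') = val P ->
  seq_class a x -> seq_class a' x' -> h x = h x' -> seq_class a = seq_class a'.
Proof.
move=> L_subst aP a'P ax a'x' hxx'.
have [y Ay] : val A !=set0.
  by have [y ->] := prime_is_rel_class A; exists y.
have Pyx : val P (y ++ x) by rewrite -aP; exists y, x.
have Pyx' : val P (y ++ x') by rewrite -a'P; exists y, x'.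
have [[z Pz] Plive _ _] := set_valP P.
have [[u v] uv] := Plive _ Pyx.
have : contexts L (y ++ x') (u, v).
  by move: Pyx Pyx' uv; rewrite Pz => -[Dx _] [<- _]; rewrite Dx.
rewrite /contexts /= -catA catA => uv'.
move: uv; rewrite /contexts /= -catA catA => uv.
have xx' : theta h L x x'.
  by split=> //; apply: L_subst => //; exists (u ++ y, v).
have [w aw] := seq_class_is_rel_class a.
have [w' a'w'] := seq_class_is_rel_class a'.
move: ax a'x'; rewrite aw a'w' => /theta_rel_class -> /theta_rel_class ->.
exact: theta_rel_class.
Qed.

Lemma finite_setT_rprime :
  finite_set (rel_primes h L) -> finite_set [set: rprime h L].
Proof.
move=> /(finite_preimage (f := fun P : rprime h L => val P)) fin.
apply: sub_finite_set (fin _) => [P _|P Q _ _]; last exact: val_inj.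
exact: set_valP.
Qed.

(** The part of [Val P] outside [Unsat P]. The tail is automatically nonempty, as valid right-hand
    sides have length at least 2. *)
Definition Sat P : set (seq (rprime h L)) :=
  [set w | exists A a, [/\ w = A :: a, Val P w & tail_saturated a]].

Lemma Val_split P : Val P = Sat P `|` Unsat P.
Proof.
apply/seteqP; split=> [w Pw|w [[A [a [-> ]]]|[]]] //.
have [[sw _] _] := Pw; case: w Pw sw => // A a PAa sa.
have [a_sat|a_unsat] := pselect (tail_saturated a).
- by left; exists A, a.
- by right; split=> //; exists A, a; split=> // a0; rewrite a0 in sa.
Qed.

Lemma Sat_bounded_size : finite_set [set: M] -> substitutable h L ->
  finite_set (rel_primes h L) -> bounded_size (\bigcup_(P : rprime h L) Sat P).
Proof.
move=> M_finite L_subst primes_finite.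
(* Sort the saturated tails by left-hand prime, head and a value of [h] on the tail class: finitely
   many families, each with a single tail class. *)
pose tails (t : rprime h L * rprime h L * M) := [set a |
  [/\ Val t.1.1 (t.1.2 :: a), tail_saturated a &
      exists2 x, seq_class a x & h x = t.2]].
have P_finite := finite_setT_rprime primes_finite.
have tails_bounded t : bounded_size (tails t).
  case: t => -[P A] m.
  have [[a0 [PAa0 _ [x a0x hx]]]|none] := pselect (tails (P, A, m) !=set0).
  (* The word [x] of the fixed tail [a0] lies in the common class, hence by saturation in
     [seq_prod a] for every [a] of the family. *)
  - exists (size x) => a [PAa a_sat [y ay hy]]; apply: size_seq_prod.
    rewrite a_sat (tail_class_eq L_subst PAa.1.2 PAa0.1.2 ay a0x) //.
    by rewrite hx.
  - by exists 0%N => a ta; case: none; exists a.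
have [n nP] : bounded_size (\bigcup_t tails t).
  apply: bounded_size_bigcup tails_bounded.
  by rewrite -!setXTT; do 2?apply: finite_setX.
(* The extra unit counts the head [A]. *)
exists n.+1 => _ [P _ [A [a [-> PAa a_sat]]]] /=; rewrite ltnS.
have [x ax] : seq_class a !=set0.
  by have [x ->] := seq_class_is_rel_class a; exists x.
by apply: nP; exists (P, A, h x) => //; split=> //; exists x.
Qed.

Lemma VTE1_Unsat : VTE1 h L <-> forall P, Unsat P = set0.
Proof.
split=> [vte P|noUnsat P A a a0 PAa].
- apply/seteqP; split=> // w [Pw [A [a [wE a0]]]]; case.
  by apply: (vte P A) => //; rewrite -wE.
- apply: contrapT => a_unsat.
  suff : Unsat P (A :: a) by rewrite noUnsat.
  by split=> //; exists A, a.
Qed.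

End SaturatedTails.

(** * The characterizations by under-saturated productions *)

Lemma kappa_partial_ltey (Sigma : finType) (M : monoidType)
    (h : seq Sigma -> M) (L : set (seq Sigma)) :
  finite_set (rel_primes h L) ->
  (kappa_partial h L < +oo)%E <-> forall P : rprime h L, regular (Unsat P).
Proof.
move=> /finite_setT_rprime P_finite.
rewrite /kappa_partial ecard_ltey; split=> [fin P|reg].
- apply/regularP.
  (* [kappa_partial] counts only nonempty residuals, so the empty one is added back. *)
  have : finite_set ([set set0] `|` [set K : set (seq (rprime h L)) |
      K !=set0 /\ exists P u, K = residual u (Unsat P)]).
    by rewrite finite_setU; split; first exact: finite_set1.
  apply: sub_finite_set => _ [u _ <-].
  have [ne|/nonemptyPn e] := pselect (residual u (Unsat P) !=set0).
  + by right; split=> //; exists P, u.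
  + by left.
- apply: (sub_finite_set (B := \bigcup_(P : rprime h L) residuals (Unsat P))).
    by move=> _ [_ [P [u ->]]]; exists P => //; exists u.
  by apply: bigcup_finite => // P _; apply/regularP.
Qed.

Theorem corollary11p3 (Sigma : finType) (M : monoidType)
    (h : seq Sigma -> M) (L : set (seq Sigma))
    (M_finite : finite_set [set: M])
    (h_morphism : word_morphism h)
    (L_substitutable : substitutable h L)
    (primes_finite : finite_set (rel_primes h L)) :
  [/\ (VTE1 h L <-> forall P : rprime h L, Unsat P = set0),
      ((FRP h L <-> forall P : rprime h L, finite_set (Unsat P)) /\
       ((forall P : rprime h L, finite_set (Unsat P)) <->
        (rho_partial h L < +oo)%E)),
      ((FSRP h L <-> forall P : rprime h L, regular (Unsat P)) /\
       ((forall P : rprime h L, regular (Unsat P)) <->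
        (kappa_partial h L < +oo)%E)) &
      ((rho h L < +oo)%E <-> (rho_partial h L < +oo)%E)].
Proof.
have P_finite := finite_setT_rprime primes_finite.
have Sat_bounded :=
  Sat_bounded_size h_morphism M_finite L_substitutable primes_finite.
have SatP_finite (P : rprime h L) : finite_set (Sat P).
  apply: bounded_size_finite => //; apply: bounded_size_sub Sat_bounded.
  by move=> w Pw; exists P.
have Val_Unsat : bounded_size (\bigcup_(P : rprime h L) Val P) <->
    bounded_size (\bigcup_(P : rprime h L) Unsat P).
  split=> [|Unsat_bounded].
    by apply: bounded_size_sub => w [P _ [Pw _]]; exists P.
  apply: bounded_size_sub (bounded_sizeU Sat_bounded Unsat_bounded).
  by move=> w [P _]; rewrite Val_split => -[Pw|Pw]; [left|right]; exists P.
have Unsat_finite : (forall P : rprime h L, finite_set (Unsat P)) <->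
    bounded_size (\bigcup_(P : rprime h L) Unsat P).
  split=> [fin|bnd P].
    by apply: bounded_size_bigcup => // P; exact: finite_bounded_size.
  apply: bounded_size_finite => //; apply: bounded_size_sub bnd.
  by move=> w Pw; exists P.
have FRP_bounded : FRP h L <-> bounded_size (\bigcup_(P : rprime h L) Val P).
  split=> [[_ /(finite_image snd)/finite_bounded_size]|bnd].
    by apply: bounded_size_sub => w [P _ Pw]; exists (P, w).
  (* Over the finite alphabet of primes, bounded length leaves finitely many right-hand sides. *)
  split=> //; apply: sub_finite_set
    (finite_setX P_finite (bounded_size_finite P_finite bnd)).
  by move=> [P w] /= Pw; split=> //; exists P.
split.
- exact: VTE1_Unsat.
- by rewrite FRP_bounded Val_Unsat Unsat_finite sup_size_ltey.
- split; last by rewrite kappa_partial_ltey.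
  split=> [[_ reg] P|reg].
  (* The removed set [Val P \ Unsat P] lies in [Sat P], so it is finite and therefore regular. *)
  + suff -> : Unsat P = Val P `\` (Val P `\` Unsat P).
      apply: regularD => //; apply: finite_regular => //.
      apply: sub_finite_set (SatP_finite P) => w.
      by rewrite Val_split => -[[]].
    apply/seteqP; split=> w.
      by move=> Pw; split; [exact: Pw.1 | case].
    by move=> [Pw nw]; apply: contrapT => Uw; apply: nw.
  + split=> // P; rewrite Val_split; apply: regularU => //.
    exact: finite_regular.
- by rewrite !sup_size_ltey.
Qed.
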